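(* Let $V$ be a finite-dimensional vector space equipped with an inner product $(\cdot,\cdot)$, let $A\colon V\to V$ be symmetric positive semidefinite, let $f\in\mathcal R(A)$, let $B\colon V\to V$ be a linear operator, and let $Q\colon V\to\mathcal R(A)$ be the orthogonal projection onto $\mathcal R(A)$. Set $\bar B=B+B^t-B^tAB$. If the operator $\bar B_Q=Q\bar BQ^t\colon\mathcal R(A)\to\mathcal R(A)$ is SPD, then the iterative method $u^{m+1}=u^m+B(f-Au^m)$, $m\ge0$, for solving $Au=f$ converges, and it satisfies $$|I-BA|_A^2=1-\left(\sup_{v\in\mathcal R(A),\ |v|_A=1}(\bar B_Q^{-1}v,v)\right)^{-1}.$$
   Context: $T^t$ is the adjoint and $\mathcal R(T)$ the range of a linear operator $T$; $Q^t$ is the natural embedding $\mathcal R(A)\to V$; $I$ is the identity on $V$. A symmetric operator $T$ is SPD if $(Tv,v)>0$ for all $v\ne0$, and symmetric positive semidefinite (semi-SPD) if $(Tv,v)\ge 0$ for all $v$. For semi-SPD $T$, $|v|_T=(Tv,v)^{1/2}$, and for a linear operator $S\colon V\to V$, $|S|_T=\sup_{v\in V,\ |v|_T=1}|Sv|_T$. Convergence of an iterative method $\{u^m\}$ for the semi-SPD system $Au=f$ means: $Qu^m\to Qu$ for every initial guess $u^0\in V$, where $u$ is a solution of $Au=f$ ($Qu$ does not depend on the choice of $u$). *)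

(* Defs.v *)
From HB Require Import structures.
From mathcomp Require Import all_boot all_order all_algebra.
From mathcomp Require Import all_classical all_reals all_analysis.
Import Order.TTheory GRing.Theory Num.Theory.
Import numFieldNormedType.Exports.

Set Implicit Arguments.
Unset Strict Implicit.
Unset Printing Implicit Defensive.

Local Open Scope classical_set_scope.
Local Open Scope ring_scope.

(* An inner product on a real space V is a [{dot V for idfun}]: a bilinear,
   symmetric, positive definite form V -> V -> R. *)

Definition sub_dot (R : realType) (V : vectType R) (dp : {dot V for idfun})
    (W : {vspace V}) : subvs_of W -> subvs_of W -> R :=
  fun x y => dp (vsval x) (vsval y).

Section SubDot.
Variables (R : realType) (V : vectType R) (dp : {dot V for idfun}).
Variable W : {vspace V}.

Fact sub_dot_is_bilinear :
  bilinear_for (GRing.Scale.Law.clone _ _ *%R _)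
    (GRing.Scale.Law.clone _ _ (idfun \; *%R) _) (@sub_dot R V dp W).
Proof.
split=> z c x y; rewrite /sub_dot /=.
- by rewrite linearPl.
- by rewrite linearPr.
Qed.

HB.instance Definition _ :=
  bilinear_isBilinear.Build R (subvs_of W) (subvs_of W) R *%R (idfun \; *%R)
    (@sub_dot R V dp W) sub_dot_is_bilinear.

Fact sub_dot_sym (x y : subvs_of W) :
  @sub_dot R V dp W x y = (-1) ^+ false * idfun (@sub_dot R V dp W y x).
Proof. exact: hermC. Qed.

HB.instance Definition _ :=
  isHermitianSesquilinear.Build R (subvs_of W) false idfun
    (@sub_dot R V dp W) sub_dot_sym.

Fact sub_dot_gt0 (x : subvs_of W) : x != 0 -> 0 < @sub_dot R V dp W x x.
Proof.
move=> x0; apply: neq0_dnorm_gt0.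
by apply: contra_neq x0 => x0; apply: val_inj; rewrite /= x0.
Qed.

HB.instance Definition _ :=
  isDotProduct.Build R (subvs_of W) (@sub_dot R V dp W) sub_dot_gt0.
End SubDot.

Section Operators.
Variables (R : realType) (V : vectType R) (dp : {dot V for idfun}).

Definition is_adjoint (T Tt : 'End(V)) : Prop :=
  forall u v, dp (T u) v = dp u (Tt v).

Definition symmetric_op (T : 'End(V)) : Prop :=
  forall u v, dp (T u) v = dp u (T v).

Definition spd (T : 'End(V)) : Prop :=
  symmetric_op T /\ forall v, v != 0 -> 0 < dp (T v) v.

Definition semi_spd (T : 'End(V)) : Prop :=
  symmetric_op T /\ forall v, 0 <= dp (T v) v.

Definition dot_norm (v : V) : R := Num.sqrt (dp v v).

Definition op_seminorm (T : 'End(V)) (v : V) : R := Num.sqrt (dp (T v) v).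

(* The norm |S|_T; the supremum is taken in the extended reals, so it is +oo,
   and not a default real value, when S is unbounded for |.|_T.
   When T = 0 the set is empty and its [ereal_sup] is -oo. *)
Definition opnorm (T S : 'End(V)) : \bar R :=
  ereal_sup [set (op_seminorm T (S v))%:E | v in [set v | op_seminorm T v = 1]].

Definition embedding (W : {vspace V}) : 'Hom(subvs_of W, V) := linfun vsval.

Definition is_orthoproj (W : {vspace V}) (Q : 'Hom(V, subvs_of W)) : Prop :=
  forall v, v - vsval (Q v) \in orthov dp W.

End Operators.

Section LinearIteration.
Variables (R : realType) (V : vectType R) (dp : {dot V for idfun}).

Definition linear_iteration (A B : 'End(V)) (f u0 : V) (m : nat) : V :=
  iter m (fun u => u + B (f - A u)) u0.

(* Convergence, in the inner-product norm of R(A), of Q u^m to Q u for every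
   initial guess and every solution u of A u = f; [meth u0] is the
   sequence of iterates with initial guess [u0]. *)
Definition method_converges (A : 'End(V)) (Q : 'Hom(V, subvs_of (limg A)))
    (f : V) (meth : V -> nat -> V) : Prop :=
  forall u0 u : V, A u = f ->
    dot_norm (sub_dot dp (W := limg A)) (Q (meth u0 m) - Q u)
      @[m --> \oo] --> (0 : R).

End LinearIteration.

(* Main.v *)
(* Write W for R(A), M for Bbar_Q and A also for its compression to W, where it
   is SPD. Expanding the square gives, with x = Q v,
     |(I - B A) v|_A^2 = (A x, x) - (M A x, A x).
   For SPD operators, M^-1 <= s A is equivalent to A^-1 <= s M (Cauchy-Schwarz),
   that is to A <= s A M A. Hence the best constant s with M^-1 <= s A, which is
   the supremum in the formula, is also the best constant with
   |(I - B A) v|_A^2 <= (1 - 1/s) |v|_A^2. Since V is finite dimensional, s is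
   finite, so the energy of the error decays geometrically. *)
Require Import Defs.
From HB Require Import structures.
From mathcomp Require Import all_boot all_order all_algebra.
From mathcomp Require Import all_classical all_reals all_analysis.
From mathcomp Require Import ring lra.
Import Order.TTheory GRing.Theory Num.Theory.
Import numFieldNormedType.Exports.

Set Implicit Arguments.
Unset Strict Implicit.
Unset Printing Implicit Defensive.

Local Open Scope classical_set_scope.
Local Open Scope ring_scope.

(** * SPD operators and Cauchy-Schwarz *)

Section DotSpace.
Variables (R : realType) (V : vectType R) (dp : {dot V for idfun}).
Implicit Types (S T : 'End(V)) (u v w : V).

Lemma dotC u v : dp u v = dp v u.
Proof. by rewrite hermC /= expr0 mul1r. Qed.

Lemma dotDl u v w : dp (u + v) w = dp u w + dp v w.
Proof. by rewrite linearDl. Qed.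

Lemma dotBl u v w : dp (u - v) w = dp u w - dp v w.
Proof. by rewrite linearBl. Qed.

Lemma dotZl a u v : dp (a *: u) v = a * dp u v.
Proof. by rewrite linearZl. Qed.

Lemma dotDr u v w : dp w (u + v) = dp w u + dp w v.
Proof. by rewrite linearDr. Qed.

Lemma dotBr u v w : dp w (u - v) = dp w u - dp w v.
Proof. by rewrite linearBr. Qed.

Lemma dot0r v : dp v 0 = 0.
Proof. exact: linear0r. Qed.

Lemma dotZr a u v : dp v (a *: u) = a * dp v u.
Proof. by rewrite linearZr. Qed.

Lemma dot_suml I (r : seq I) (F : I -> V) v :
  dp (\sum_(i <- r) F i) v = \sum_(i <- r) dp (F i) v.
Proof.
by elim/big_rec2: _ => [|i x y _ <-]; rewrite ?linear0l // dotDl.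
Qed.

Lemma spd1 : spd dp \1%VF.
Proof.
split=> [u v|v v0]; first by rewrite !id_lfunE.
by rewrite id_lfunE neq0_dnorm_gt0.
Qed.

Lemma spd_ge0 T v : spd dp T -> 0 <= dp (T v) v.
Proof.
move=> [_ T0]; have [->|/T0/ltW //] := eqVneq v 0.
by rewrite dot0r.
Qed.

Lemma dot_ge0 v : 0 <= dp v v.
Proof. by have := spd_ge0 v spd1; rewrite id_lfunE. Qed.

Lemma spd_ker0 T : spd dp T -> lker T == 0%VS.
Proof.
move=> [_ T0]; rewrite -subv0; apply/subvP=> v; rewrite memv_ker => /eqP Tv.
rewrite memv0; apply/negPn/negP => /T0.
by rewrite Tv linear0l ltxx.
Qed.

Lemma spd_inv T : spd dp T -> spd dp T^-1%VF.
Proof.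
move=> Tspd; have [Tsym T0] := Tspd; have kT := spd_ker0 Tspd.
split=> [u v|v v0].
  by rewrite -{2}(lker0_lfunVK kT u) Tsym (lker0_lfunVK kT).
rewrite -{2}(lker0_lfunVK kT v) -Tsym T0 //.
by apply: contra_neq v0 => v0; rewrite -(lker0_lfunVK kT v) v0 linear0.
Qed.

Lemma semi_spd_CauchySchwarz T u v : semi_spd dp T ->
  dp (T u) v ^+ 2 <= dp (T u) u * dp (T v) v.
Proof.
move=> [Tsym T0]; set a := dp (T u) u; set b := dp (T u) v.
set c := dp (T v) v.
have b_sym : dp (T v) u = b by rewrite Tsym dotC.
have ge0 x y : 0 <= x * (x * a) + x * (y * b) + (y * (x * b) + y * (y * c)).
  have := T0 (x *: u + y *: v).
  have -> : T (x *: u + y *: v) = x *: T u + y *: T v.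
    by rewrite linearD !linearZ.
  by rewrite dotDl !dotDr !dotZl !dotZr b_sym.
have := T0 v; rewrite -/c le_eqVlt => /predU1P[c0|c_gt0]; last first.
  (* For fixed x the form is smallest at y = - x b / c; taking x = c clears the denominator. *)
  have := ge0 c (- b).
  have -> : c * (c * a) + c * (- b * b) + (- b * (c * b) + - b * (- b * c))
    = c * (a * c - b ^+ 2) by ring.
  by rewrite pmulr_rge0 // subr_ge0.
rewrite -c0 mulr0; have [->|b0] := eqVneq b 0; first by rewrite expr0n.
(* With c = 0 and x = 1 the form is a + 2 y b, affine in y; this y gives it the value -1. *)
have := ge0 1 (- (a + 1) / (2 * b)); rewrite -c0.
have -> : 1 * (1 * a) + 1 * (- (a + 1) / (2 * b) * b)
  + (- (a + 1) / (2 * b) * (1 * b)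
     + - (a + 1) / (2 * b) * (- (a + 1) / (2 * b) * 0)) = - 1 by field.
by rewrite oppr_ge0 ler10.
Qed.

Lemma spd_CauchySchwarz T u v : spd dp T ->
  dp (T u) v ^+ 2 <= dp (T u) u * dp (T v) v.
Proof.
move=> Tspd; apply: semi_spd_CauchySchwarz; split=> [|w].
  by have [] := Tspd.
exact: spd_ge0.
Qed.

(** Cauchy-Schwarz against [T v] bounds |T v|^4 by a multiple of (T v, v). *)
Lemma semi_spd_eq0 T v : semi_spd dp T -> dp (T v) v = 0 -> T v = 0.
Proof.
move=> Tpos Tv0; apply/eqP/negPn/negP => /(proj2 spd1); apply/negP.
have := semi_spd_CauchySchwarz v (T v) Tpos.
by rewrite id_lfunE Tv0 mul0r -leNgt; have := dot_ge0 (T v); nra.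
Qed.

(** * Comparison of quadratic forms and of inverses *)

(** Both sides scale quadratically. This turns bounds on an energy unit sphere, as in the two
    suprema, into inequalities between forms. *)
Lemma unit_sphere_le S T c : spd dp S ->
  (forall v, dp (S v) v = 1 -> dp (T v) v <= c) ->
  forall v, dp (T v) v <= c * dp (S v) v.
Proof.
move=> [_ S0] le_c v; have [->|/S0 v0] := eqVneq v 0.
  by rewrite !dot0r mulr0.
set t := Num.sqrt (dp (S v) v).
have t_gt0 : 0 < t by rewrite sqrtr_gt0.
have tt : t ^+ 2 = dp (S v) v by rewrite sqr_sqrtr // ltW.
have scale (U : 'End(V)) : dp (U (t^-1 *: v)) (t^-1 *: v) = dp (U v) v / t ^+ 2.
  have -> : U (t^-1 *: v) = t^-1 *: U v by rewrite linearZ.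
  by rewrite dotZl dotZr; field; exact: lt0r_neq0.
have := le_c (t^-1 *: v); rewrite !scale tt divff ?lt0r_neq0 // => /(_ erefl).
by rewrite ler_pdivrMr.
Qed.

Lemma inv_id_lfun : (\1^-1 = \1 :> 'End(V))%VF.
Proof.
have k1 := spd_ker0 spd1.
by apply/lfunP => x; rewrite -{1}[x](id_lfunE) (lker0_lfunK k1) id_lfunE.
Qed.

(** Put w = S^-1 v. Cauchy-Schwarz for T at v and T^-1 w gives (w, v)^2 <= (T v, v) (T^-1 w, w); the
    last factor is at most s (w, v), and one (w, v) > 0 cancels. *)
Lemma inverse_antitone S T s : spd dp S -> spd dp T ->
  (forall w, dp (T^-1%VF w) w <= s * dp (S w) w) ->
  forall v, dp (S^-1%VF v) v <= s * dp (T v) v.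
Proof.
move=> Sspd Tspd le_s v; have [->|v0] := eqVneq v 0.
  by rewrite !dot0r mulr0.
have [_ /(_ v v0) Sv0] := spd_inv Sspd.
have kT := spd_ker0 Tspd; have kS := spd_ker0 Sspd.
have [Tsym _] := Tspd.
have CS := spd_CauchySchwarz v (T^-1%VF (S^-1%VF v)) Tspd.
move: CS; rewrite Tsym (lker0_lfunVK kT).
rewrite (dotC (S^-1%VF v) (T^-1%VF _)) dotC => CS.
have := le_s (S^-1%VF v).
rewrite (lker0_lfunVK kS) (dotC v) => le1.
have : dp (S^-1%VF v) v ^+ 2 <= s * dp (T v) v * dp (S^-1%VF v) v.
  apply: le_trans CS _.
  by rewrite [s * _]mulrC -mulrA ler_wpM2l // spd_ge0.
by rewrite expr2 ler_pM2r.
Qed.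

(** Both directions are [inverse_antitone], the second with S and T exchanged; substituting [S v]
    for v removes the inverse of S. *)
Lemma inverse_leP S T s : spd dp S -> spd dp T ->
  (forall v, dp (T^-1%VF v) v <= s * dp (S v) v) <->
  (forall v, dp (S v) v <= s * dp (T (S v)) (S v)).
Proof.
move=> Sspd Tspd; have kS := spd_ker0 Sspd.
split=> [le_s v|le_s].
  have := inverse_antitone Sspd Tspd le_s (S v).
  by rewrite (lker0_lfunK kS) dotC.
apply: inverse_antitone => // v.
by have := le_s (S^-1%VF v); rewrite (lker0_lfunVK kS) dotC.
Qed.

(* The frame operator of a basis b reproduces v as the sum of the
   (v, frame^-1 e) e over e in b, so Cauchy-Schwarz bounds the coordinates of v
   by its norm. *)
Let b := vbasis (fullv : {vspace V}).

Let frame_fun (v : V) : V := \sum_(e <- b) dp v e *: e.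

Let frame_fun_linear : linear frame_fun.
Proof.
move=> a u v; rewrite /frame_fun scaler_sumr -big_split /=.
by apply: eq_bigr => e _; rewrite dotDl dotZl scalerDl scalerA.
Qed.

HB.instance Definition _ := GRing.isLinear.Build R V V *:%R frame_fun
  frame_fun_linear.

Let frame : 'End(V) := linfun frame_fun.

Lemma dot_frame u v : dp (frame u) v = \sum_(e <- b) dp u e * dp v e.
Proof.
rewrite lfunE /= dot_suml; apply: eq_bigr => e _.
by rewrite dotZl (dotC e).
Qed.

(** A vector orthogonal to every basis vector is orthogonal to its own expansion, hence zero. *)
Lemma frame_spd : spd dp frame.
Proof.
split=> [u v|v v0].
  rewrite (dotC u) !dot_frame; apply: eq_bigr => e _; exact: mulrC.
rewrite lt_def dot_frame sumr_ge0 ?andbT => [|e _]; last by rewrite -expr2 sqr_ge0.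
apply: contra_neq v0 => /eqP; rewrite psumr_eq0 => [/allP ve|e _]; last first.
  by rewrite -expr2 sqr_ge0.
apply/eqP/negPn/negP => /(proj2 spd1); apply/negP.
rewrite -leNgt id_lfunE {1}(coord_vbasis (memvf v)) dot_suml big1 // => i _.
have := ve b`_i; rewrite mem_nth ?size_tuple // => /(_ isT); rewrite mulf_eq0 orbb => /eqP vb.
by rewrite dotZl dotC vb mulr0.
Qed.

Lemma spd_bounded T : exists2 C : R, 0 < C &
  forall v, dp (T v) v <= C * dp v v.
Proof.
have kF := spd_ker0 frame_spd; have [symF _] := spd_inv frame_spd.
(* Each term (v, frame^-1 e) (T e, v) is at most half the sum of the squares of its factors, which
   Cauchy-Schwarz bounds by |frame^-1 e|^2 |v|^2 and |T e|^2 |v|^2. *)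
pose c := \sum_(e <- b) (dp (frame^-1%VF e) (frame^-1%VF e) + dp (T e) (T e)).
have c0 : 0 <= c by apply: sumr_ge0 => e _; rewrite addr_ge0 // dot_ge0.
exists (c + 1) => [|v]; first by rewrite ltr_wpDl.
have -> : T v = \sum_(e <- b) dp v (frame^-1%VF e) *: T e.
  rewrite -{1}(lker0_lfunVK kF v) [frame _]lfunE /= /frame_fun linear_sum.
  by apply: eq_bigr => e _; rewrite linearZ /= symF.
apply: (@le_trans _ _ (c * dp v v)); last first.
  by rewrite ler_wpM2r ?lerDl // dot_ge0.
rewrite dot_suml mulr_suml; apply: ler_sum => e _; rewrite dotZl.
have CS x : dp v x ^+ 2 <= dp x x * dp v v.
  by have := spd_CauchySchwarz v x spd1; rewrite !id_lfunE mulrC.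
have := CS (frame^-1%VF e); have := CS (T e); rewrite (dotC (T e) v) mulrDl.
set x := dp v _; set y := dp v _.
have := sqr_ge0 (x - y); have := sqr_ge0 (x + y).
have := dot_ge0 v; have := dot_ge0 (T e).
have := dot_ge0 (frame^-1%VF e).
by nra.
Qed.

(** T^-1 <= c1 I, and S^-1 <= c2 I inverts to I <= c2 S. This keeps the supremum finite. *)
Lemma spd_inv_dominated S T : spd dp S -> spd dp T -> exists2 C : R, 0 < C &
  forall v, dp (T^-1%VF v) v <= C * dp (S v) v.
Proof.
move=> Sspd Tspd.
have [c1 c1_gt0 le1] := spd_bounded T^-1%VF.
have [c2 c2_gt0 le2] := spd_bounded S^-1%VF.
exists (c1 * c2) => [|v]; first exact: mulr_gt0.
apply: le_trans (le1 v) _; rewrite -mulrA ler_pM2l //.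
have := @inverse_antitone \1%VF S c2 spd1 Sspd.
rewrite inv_id_lfun => /(_ _ v); rewrite id_lfunE; apply => w.
by rewrite id_lfunE.
Qed.

End DotSpace.

(** * Projection onto R(A) and the energy of the error *)

Section IterationError.
Variables (R : realType) (V : vectType R) (dp : {dot V for idfun}).
Variables (A B Bt : 'End(V)) (Q : 'Hom(V, subvs_of (limg A))).
Hypotheses (Apos : semi_spd dp A) (adjB : is_adjoint dp B Bt).
Hypothesis projQ : is_orthoproj dp Q.

Local Notation W := (subvs_of (limg A)).
Let dpA : {dot W for idfun} := sub_dot dp (W := limg A).
Let AQ : 'End(W) := (Q \o A \o embedding (limg A))%VF.
Let Bbar : 'End(V) := B + Bt - (Bt \o A \o B)%VF.
Let BbarQ : 'End(W) := (Q \o Bbar \o embedding (limg A))%VF.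
Let S : 'End(V) := (\1%VF - (B \o A)%VF)%R.

Lemma orthoproj_dot u (w : W) : dpA (Q u) w = dp u (vsval w).
Proof.
have uQ : dp (u - vsval (Q u)) (vsval w) = 0.
  by have /mem_orthovP/(_ _ (subvsP w)) := projQ u.
by apply/esym/eqP; rewrite -subr_eq0 -uQ dotBl.
Qed.

Lemma orthoprojK (w : W) : Q (vsval w) = w.
Proof.
apply/eqP; rewrite -subr_eq0; apply/negPn/negP => /(proj2 (spd1 dpA)).
by rewrite id_lfunE dotBl orthoproj_dot /dpA /sub_dot subrr ltxx.
Qed.

Lemma orthoproj_limg v : v \in limg A -> vsval (Q v) = v.
Proof.
by move=> vA; rewrite -{1}(vsprojK vA) orthoprojK vsprojK.
Qed.

(** For r = v - Q v, (A r, A r) = (r, A (A r)) = 0, as r is orthogonal to R(A). Energies therefore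
    depend on Q v only. *)
Lemma orthoproj_op v : A (vsval (Q v)) = A v.
Proof.
apply/esym/eqP; rewrite -subr_eq0 -linearB.
apply/negPn/negP => /(proj2 (spd1 dp)); rewrite id_lfunE (proj1 Apos).
have /mem_orthovP-> := projQ v; first by rewrite ltxx.
exact: memv_img (memvf _).
Qed.

Lemma compressionE (T : 'End(V)) (x y : W) :
  dpA ((Q \o T \o embedding (limg A))%VF x) y = dp (T (vsval x)) (vsval y).
Proof. by rewrite !comp_lfunE orthoproj_dot [embedding _ _]lfunE. Qed.

(** If (A x, x) = 0 then A x = 0; writing x = A y gives (x, x) = (A x, y) = 0. *)
Lemma compression_spd : spd dpA AQ.
Proof.
have [Asym A0] := Apos; split=> [x y|x x0].
  by rewrite (dotC dpA x) !compressionE Asym dotC.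
rewrite compressionE lt_def A0 andbT; apply: contra_neq x0 => Ax0.
have {}Ax0 : A (vsval x) = 0 by exact: semi_spd_eq0 Ax0.
have xx0 : dpA x x = 0.
  have /memv_imgP[y _ xy] := subvsP x.
  change (dp (vsval x) (vsval x) = 0).
  by rewrite {2}xy -Asym Ax0 dotC dot0r.
by apply/eqP/negPn/negP => /(proj2 (spd1 dpA)); rewrite id_lfunE xx0 ltxx.
Qed.

Lemma energy_orthoproj v : dp (A v) v = dpA (AQ (Q v)) (Q v).
Proof.
have [Asym _] := Apos.
by rewrite compressionE orthoproj_op [RHS]Asym orthoproj_op -Asym.
Qed.

Lemma energy_error v : dp (A (S v)) (S v) =
  dpA (AQ (Q v)) (Q v) - dpA (BbarQ (AQ (Q v))) (AQ (Q v)).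
Proof.
have [Asym _] := Apos; rewrite -energy_orthoproj.
(* [AQ (Q v)] is A v seen in R(A), so the projections drop out of the form of [BbarQ]. *)
have -> : AQ (Q v) = Q (A v).
  by rewrite !comp_lfunE [embedding _ _]lfunE /= orthoproj_op.
rewrite compressionE orthoproj_limg ?memv_img ?memvf //.
have -> : S v = v - B (A v) by rewrite !lfun_simp.
have -> : Bbar (A v) = B (A v) + Bt (A v) - Bt (A (B (A v))).
  by rewrite !lfun_simp.
have -> : A (v - B (A v)) = A v - A (B (A v)) by rewrite linearB.
rewrite dotBl !dotBr dotBl dotDl.
have -> : dp (Bt (A v)) (A v) = dp (B (A v)) (A v) by rewrite adjB dotC.
have -> : dp (Bt (A (B (A v)))) (A v) = dp (A (B (A v))) (B (A v)).
  by rewrite dotC -adjB dotC.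
have -> : dp (A (B (A v))) v = dp (B (A v)) (A v) by rewrite Asym.
by rewrite (dotC dp (A v) (B _)); ring.
Qed.

Lemma energy_error_le s : 0 < s -> spd dpA BbarQ ->
  (forall x, dpA (BbarQ^-1%VF x) x <= s * dpA (AQ x) x) ->
  forall v, dp (A (S v)) (S v) <= (1 - s^-1) * dp (A v) v.
Proof.
move=> s0 Bspd /(inverse_leP _ compression_spd Bspd) le_s v.
rewrite energy_error energy_orthoproj mulrBl mul1r lerB // mulrC.
by rewrite ler_pdivrMr // mulrC; exact: le_s.
Qed.

(** * Convergence of the iteration *)

Lemma iteration_error f u0 u m : A u = f ->
  linear_iteration A B f u0 m - u = iter m S (u0 - u).
Proof.
move=> Auf; rewrite /linear_iteration; elim: m => //= m <-.
set x := iter m _ u0.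
have -> : S (x - u) = (x - u) - B (A (x - u)) by rewrite !lfun_simp.
have -> : A (x - u) = - (f - A x) by rewrite opprB -Auf; exact: linearB.
by rewrite linearN opprK addrAC.
Qed.

Lemma iteration_converges f : spd dpA BbarQ ->
  method_converges dp Q f (linear_iteration A B f).
Proof.
move=> Bspd u0 u Auf.
have [C C_gt0 leC] := spd_inv_dominated compression_spd Bspd.
(* As I is its own inverse, this bounds the inner-product norm on R(A) by the energy. *)
have [K K_gt0 leK] := spd_inv_dominated compression_spd (spd1 dpA).
(* Adding 1 to C makes s > 1, so that the contraction factor q lies in [0, 1). *)
pose s := C + 1; pose q := 1 - s^-1; pose E v := dp (A v) v.
have s_gt1 : 1 < s by rewrite /s ltrDr.
have s_gt0 : 0 < s by exact: lt_trans s_gt1.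
have q_ge0 : 0 <= q by rewrite subr_ge0 invf_le1 // ltW.
have q_lt1 : q < 1 by rewrite ltrBlDr ltrDl invr_gt0.
have EQ v : dpA (Q v) (Q v) <= K * E v.
  by have := leK (Q v); rewrite (inv_id_lfun dpA) id_lfunE /E energy_orthoproj.
have le_s x : dpA (BbarQ^-1%VF x) x <= s * dpA (AQ x) x.
  apply: le_trans (leC x) _; rewrite ler_wpM2r ?lerDl //.
  exact: spd_ge0 compression_spd.
have Eiter m : E (iter m S (u0 - u)) <= q ^+ m * E (u0 - u).
  elim: m => [|m IHm]; first by rewrite expr0 mul1r.
  apply: le_trans (energy_error_le s_gt0 Bspd le_s _) _.
  by rewrite exprS -mulrA ler_wpM2l.
apply: (@squeeze_cvgr _ _ _ _ (fun=> 0)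
  (fun m => Num.sqrt (geometric (K * E (u0 - u)) q m))).
- near=> m; rewrite sqrtr_ge0 /= /dot_norm -linearB ler_wsqrtr //.
  rewrite (iteration_error _ _ Auf); apply: le_trans (EQ _) _.
  by rewrite -mulrA ler_pM2l // mulrC.
- exact: cvg_cst.
- rewrite -[X in _ --> X]sqrtr0.
  apply: (cvg_comp (geometric (K * E (u0 - u)) q) Num.sqrt).
    by apply: cvg_geometric; rewrite ger0_norm.
  exact: sqrt_continuous.
Unshelve. all: by end_near.
Qed.

(** * The norm of the error operator *)

Lemma op_seminorm_eq1 v : op_seminorm dp A v = 1 <-> dp (A v) v = 1.
Proof.
rewrite /op_seminorm; split=> [v1|->]; last exact: sqrtr1.
by rewrite -(sqr_sqrtr ((proj2 Apos) v)) v1 expr1n.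
Qed.

Lemma energy_vsval x : dpA (AQ x) x = dp (A (vsval x)) (vsval x).
Proof. exact: compressionE. Qed.

(** Converse of [energy_error_le], with c in the role of 1 - 1/s: by the energy identity the bound
    reads (1 - c) A <= A M A on R(A), and [inverse_leP] inverts it. *)
Lemma le_energy_error c : spd dpA BbarQ -> 0 <= c ->
  (forall v, dp (A v) v = 1 -> dp (A (S v)) (S v) <= c) -> c < 1 ->
  forall x, dpA (BbarQ^-1%VF x) x <= (1 - c)^-1 * dpA (AQ x) x.
Proof.
move=> Bspd c_ge0 le_c c_lt1.
(* [unit_sphere_le] yields upper bounds, so the lower bound on A M A is stated for its negative. *)
have ABA x : dpA ((- (AQ \o BbarQ \o AQ)%VF : 'End(W)) x) x
    = - dpA (BbarQ (AQ x)) (AQ x).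
  have -> : (- (AQ \o BbarQ \o AQ)%VF : 'End(W)) x = - 1 *: AQ (BbarQ (AQ x)).
    by rewrite opp_lfunE 2!comp_lfunE scaleN1r.
  by rewrite dotZl mulN1r (proj1 compression_spd).
have le_ABA : forall x, dpA ((- (AQ \o BbarQ \o AQ)%VF : 'End(W)) x) x
    <= (c - 1) * dpA (AQ x) x.
  apply: unit_sphere_le compression_spd _ => x x1; rewrite ABA.
  have := le_c (vsval x); rewrite -energy_vsval => /(_ x1).
  by rewrite energy_error orthoprojK x1; lra.
apply/(inverse_leP _ compression_spd Bspd) => x.
have := le_ABA x; rewrite ABA => le_x.
by rewrite ler_pdivlMl ?subr_gt0 //; lra.
Qed.

Lemma opnorm_error : spd dpA BbarQ ->
  (opnorm dp A S ^+ 2 = 1 - (ereal_sup [set (dpA (BbarQ^-1%VF v) v)%:E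
    | v in [set v : W | op_seminorm dp A (vsval v) = 1%R]])^-1)%E.
Proof.
move=> Bspd; set D := [set v : W | _].
have [D0|/set0P[d Dd]] := eqVneq D set0.
  (* When A = 0 both sides are the junk value +oo, as sup set0 = -oo. *)
  have -> : opnorm dp A S = -oo%E.
    rewrite /opnorm (_ : [set v | _] = set0) ?image_set0 ?ereal_sup0 //.
    rewrite -subset0 => v /op_seminorm_eq1 v1.
    suff : D (Q v) by rewrite D0.
    by apply/op_seminorm_eq1; rewrite -energy_vsval -energy_orthoproj.
  by rewrite D0 image_set0 ereal_sup0.
have Dd1 : dpA (AQ d) d = 1 by rewrite energy_vsval; apply/op_seminorm_eq1.
have [C C_gt0 leC] := spd_inv_dominated compression_spd Bspd.
set sup := ereal_sup _.
have sup_ub x : D x -> ((dpA (BbarQ^-1%VF x) x)%:E <= sup)%E.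
  by move=> Dx; apply: ereal_sup_ubound; exists x.
have sup_le c : (forall x, D x -> dpA (BbarQ^-1%VF x) x <= c) -> (sup <= c%:E)%E.
  by move=> le_c; apply: ge_ereal_sup => _ [x Dx <-]; rewrite lee_fin le_c.
have d_neq0 : d != 0.
  apply/negP => /eqP d0; move: Dd1; rewrite d0 dot0r => /eqP.
  by rewrite eq_sym oner_eq0.
(* The value at d bounds the supremum from below and C from above, so it is a real number s. *)
have supE : sup = (fine sup)%:E.
  rewrite fineK // fin_numElt (lt_le_trans (ltNyr _) (sup_ub d Dd)) /=.
  apply: le_lt_trans (sup_le C _) (ltry _) => x /op_seminorm_eq1 Dx.
  by have := leC x; rewrite energy_vsval Dx mulr1.
move: sup_ub sup_le; rewrite supE; move: (fine sup) => s {supE} sup_ub sup_le.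
have s_gt0 : 0 < s.
  apply: lt_le_trans (proj2 (spd_inv Bspd) d d_neq0) _.
  by have := sup_ub d Dd; rewrite lee_fin.
have le_s : forall x, dpA (BbarQ^-1%VF x) x <= s * dpA (AQ x) x.
  apply: unit_sphere_le compression_spd _ => x; rewrite energy_vsval => x1.
  by rewrite -lee_fin; apply: sup_ub; apply/op_seminorm_eq1.
have leS v : dp (A v) v = 1 -> dp (A (S v)) (S v) <= 1 - s^-1.
  by move=> v1; have := energy_error_le s_gt0 Bspd le_s v; rewrite v1 mulr1.
(* The energy of the error at d is nonnegative and at most 1 - 1/s; hence the square root of 1 - 1/s
   squares back to it. *)
have q_ge0 : 0 <= 1 - s^-1.
  apply: le_trans (leS (vsval d) _); first exact: (proj2 Apos).
  by rewrite -energy_vsval.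
rewrite inver gt_eqF // -EFinB.
suff -> : opnorm dp A S = (Num.sqrt (1 - s^-1))%:E.
  by rewrite -EFin_expe sqr_sqrtr.
apply/eqP; rewrite eq_le; apply/andP; split.
  apply: ge_ereal_sup => _ [v /op_seminorm_eq1 v1 <-].
  by rewrite lee_fin ler_wsqrtr // leS.
(* If the norm were a real r below sqrt(1 - 1/s), [le_energy_error] with c = r^2 would give s <=
   1/(1 - r^2), that is r^2 >= 1 - 1/s. The vector d excludes the value -oo. *)
rewrite leNgt; apply/negP => lt_q.
have opnorm_ub v : dp (A v) v = 1 ->
    ((Num.sqrt (dp (A (S v)) (S v)))%:E <= opnorm dp A S)%E.
  by move=> /op_seminorm_eq1 v1; apply: ereal_sup_ubound; exists v.
move: (opnorm dp A S) lt_q opnorm_ub => [r| |] lt_q opnorm_ub.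
- have r_ge0 : 0 <= r.
    have := opnorm_ub (vsval d); rewrite -energy_vsval lee_fin => /(_ Dd1).
    exact/le_trans/sqrtr_ge0.
  have lt_r2 : r ^+ 2 < 1 - s^-1.
    by rewrite -(sqr_sqrtr q_ge0) ltr_pXn2r ?nnegrE ?sqrtr_ge0 -?lte_fin.
  have r2_lt1 : r ^+ 2 < 1.
    by apply: lt_le_trans lt_r2 _; rewrite gerBl invr_ge0 ltW.
  have : s <= (1 - r ^+ 2)^-1.
    rewrite -lee_fin; apply: sup_le => x /op_seminorm_eq1 Dx.
    have := le_energy_error Bspd (sqr_ge0 r) _ r2_lt1 x.
    rewrite energy_vsval Dx mulr1; apply => v v1.
    rewrite -(sqr_sqrtr (proj2 Apos (S v))) ler_pXn2r ?nnegrE ?sqrtr_ge0 //.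
    by rewrite -lee_fin opnorm_ub.
  rewrite -[leRHS]mul1r ler_pdivlMr ?subr_gt0 // mulrC -ler_pdivlMr //.
  by rewrite div1r; lra.
- by rewrite ltNge leey in lt_q.
- by have := opnorm_ub (vsval d); rewrite -energy_vsval leNgt ltNyr => /(_ Dd1).
Qed.

End IterationError.

Theorem theorem4p6 (R : realType) (V : vectType R) (dp : {dot V for idfun})
    (A B Bt : 'End(V)) (f : V) (Q : 'Hom(V, subvs_of (limg A))) :
  semi_spd dp A ->
  f \in limg A ->
  is_adjoint dp B Bt ->
  is_orthoproj dp Q ->
  let Qt := embedding (limg A) in
  let Bbar : 'End(V) := B + Bt - (Bt \o A \o B)%VF in
  let BbarQ : 'End(subvs_of (limg A)) := (Q \o Bbar \o Qt)%VF in
  let dpA : {dot subvs_of (limg A) for idfun} := sub_dot dp (W := limg A) in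
  spd dpA BbarQ ->
  method_converges dp Q f (linear_iteration A B f) /\
  (opnorm dp A (\1%VF - (B \o A)%VF)%R ^+ 2 =
   1 - (ereal_sup [set (dpA ((BbarQ^-1)%VF v) v)%:E
                  | v in [set v : subvs_of (limg A) |
                           op_seminorm dp A (vsval v) = 1%R]])^-1)%E.
Proof.
move=> Apos _ adjB projQ Qt Bbar BbarQ dpA Bspd; split.
  exact: iteration_converges Bspd.
exact: opnorm_error Bspd.
Qed.
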